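(* Let $w$ be a strictly positive or strictly negative element of Thompson's group $F$. Then the nested traversal method produces a minimal length representative for $w$: the word in $x_0^{\pm1},x_1^{\pm1}$ which it outputs represents $w$ and has length equal to $|w|$, the word length of $w$ with respect to the generating set $\{x_0,x_1\}$.
   Context: Thompson's group $F$ is the group with infinite presentation $\langle x_k,\ k\ge 0 \mid x_i^{-1}x_jx_i=x_{j+1}\ \text{for } i<j\rangle$; it is generated by $x_0,x_1$. $|w|$ denotes word length with respect to $\{x_0^{\pm1},x_1^{\pm1}\}$. Every element has a unique normal form $x_{i_1}^{r_1}\cdots x_{i_k}^{r_k}x_{j_l}^{-s_l}\cdots x_{j_1}^{-s_1}$ with $r_i,s_i>0$, $i_1<\dots<i_k$, $j_1<\dots<j_l$, such that whenever both $x_i$ and $x_i^{-1}$ occur, so does $x_{i+1}$ or $x_{i+1}^{-1}$. An element is strictly positive (resp. strictly negative) if its normal form contains only generators with positive (resp. negative) exponents. Tree pair diagrams: A tree is a finite rooted binary tree in which every vertex has either no children or two (left and right) children. A caret is a non-leaf node together with its two downward edges; the left (right) child of a caret is the caret attached to the end of its left (right) edge, if any, and its left (right) subtree is the set of all carets stemming from that edge. The exposed leaves are numbered from left to right starting with $0$. A tree pair diagram $(T_-,T_+)$ is a pair of such trees with the same number of carets. It is unreduced if, for some $m$, both trees contain a caret both of whose leaves are exposed, with leaf numbers $m$ and $m+1$; deleting that caret in both trees gives another diagram for the same element. Each nontrivial element of $F$ has a unique reduced diagram; the identity is represented by the pair of single-caret trees. The right side of a tree is the maximal path of right edges starting at the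 root (including the root); the left side is defined similarly. The exponent $E(k)$ of leaf $k$ is the length of the maximal upward path from leaf $k$ consisting only of left edges and not reaching the right side of the tree ($E(k)=0$ if leaf $k$ is a right leaf). The pair $(T_-,T_+)$ with leaves $0,\dots,m$ represents $x_0^{E_+(0)}\cdots x_m^{E_+(m)}\,x_m^{-E_-(m)}\cdots x_0^{-E_-(0)}$, where $E_\pm$ are the exponents in $T_\pm$. For a strictly negative $w$ the reduced diagram is $(T_-,* )$, where $*$ consists of the root caret and right carets only. Caret types: number the carets of a tree from $0$ in infix order (left subtree of a caret, then the caret, then its right subtree). A caret is left if its left edge is on the left side of the tree (the root is a left caret), right if it is not the root and its right edge is on the right side, and interior otherwise. Types: $L_0$: caret number $0$ (a left caret); $L_L$: any other left caret; $I_0$: an interior caret with no right child; $I_R$: an interior caret with a right child; $R_I$: a right caret numbered $k$ such that caret $k+1$ is interior; $R_{NI}$: a right caret not of type $R_I$ but for which some higher-numbered caret is interior; $R_0$: a right caret with no higher-numbered interior carets. Nested traversal method: for strictly negative $w=(T_-,* )$, the output is the word $W(T_-)$ defined recursively as follows (caret types are always the types as carets of the whole tree $T_-$). For an empty subtree $S$, $W(S)$ is the empty word. For a nonempty subtree $S$ with top caret $C$, having left subtree $S'$ and right subtree $S''$: - if $C$ has type $L_0$ or $R_0$, $W(S)=W(S')\,W(S'')$; - if $C$ has type $L_L$, $W(S)=W(S')\,x_0^{-1}\,W(S'')$; - if $C$ has type $I_0$ (so $S''=\emptyset$), $W(S)=W(S')\,x_1^{-1}$; - if $C$ has type $I_R$,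 $W(S)=W(S')\,x_0^{-1}\,W(S'')\,x_0x_1^{-1}$; - if $C$ has type $R_{NI}$ or $R_I$, $W(S)=W(S')\,x_0^{-1}\,W(S'')\,x_0$. For a strictly positive $w$, the output is the formal inverse of the word obtained by applying the method to the strictly negative element $w^{-1}$. *)

(* Defs.v *)
From HB Require Import structures.
From mathcomp Require Import all_boot.
From mathcomp Require Import boolp.

Set Implicit Arguments.
Unset Strict Implicit.
Unset Printing Implicit Defensive.

Local Open Scope group_scope.

(* The letter (a, false) stands for a, the letter (a, true) for its inverse. *)
Definition word (A : Type) := seq (A * bool).

Definition inv_letter (A : Type) (a : A * bool) : A * bool := (a.1, ~~ a.2).

Definition inv_word (A : Type) (u : word A) : word A :=
  rev (map (@inv_letter A) u).

Lemma inv_wordK (A : Type) : involutive (@inv_word A).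
Proof.
move=> u; rewrite /inv_word map_rev revK -map_comp -[RHS]map_id.
by apply: eq_map => -[a b]; rewrite /= /inv_letter negbK.
Qed.

Lemma inv_word_cat (A : Type) (u v : word A) :
  inv_word (u ++ v) = inv_word v ++ inv_word u.
Proof. by rewrite /inv_word map_cat rev_cat. Qed.

Inductive Fcongr : word nat -> word nat -> Prop :=
| Fcongr_refl u : Fcongr u u
| Fcongr_sym u v : Fcongr u v -> Fcongr v u
| Fcongr_trans u v t : Fcongr u v -> Fcongr v t -> Fcongr u t
| Fcongr_cat u u' v v' :
    Fcongr u u' -> Fcongr v v' -> Fcongr (u ++ v) (u' ++ v')
| Fcongr_cancel a : Fcongr [:: a; inv_letter a] [::]
| Fcongr_rel i j : (i < j)%N ->
    Fcongr [:: (i, true); (j, false); (i, false)] [:: (j.+1, false)].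

Lemma Fcongr_invr u : Fcongr (u ++ inv_word u) [::].
Proof.
elim: u => [|a u IHu]; first exact: Fcongr_refl.
rewrite -cat1s inv_word_cat -catA; apply: Fcongr_trans (Fcongr_cancel a).
rewrite -[[:: a; _]]/([:: a] ++ ([::] ++ inv_word [:: a])).
apply: Fcongr_cat; first exact: Fcongr_refl.
by rewrite catA; apply: Fcongr_cat => //; exact: Fcongr_refl.
Qed.

Lemma Fcongr_invl u : Fcongr (inv_word u ++ u) [::].
Proof. by have := Fcongr_invr (inv_word u); rewrite inv_wordK. Qed.

Lemma Fcongr_inv u v : Fcongr u v -> Fcongr (inv_word u) (inv_word v).
Proof.
move=> uv; have r := Fcongr_refl.
have h1 : Fcongr (inv_word u) ((inv_word u ++ v) ++ inv_word v).
  rewrite -catA -{1}[inv_word u]cats0; apply: Fcongr_cat (r _) _.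
  exact/Fcongr_sym/Fcongr_invr.
apply: Fcongr_trans h1 _; rewrite -{2}[inv_word v]cat0s.
apply: Fcongr_cat (r _); apply: Fcongr_trans _ (Fcongr_invl u).
by apply: Fcongr_cat (r _) _; exact: Fcongr_sym.
Qed.

Definition Fcongrb : rel (word nat) := fun u v => `[< Fcongr u v >].

Lemma Fcongrb_refl : reflexive Fcongrb.
Proof. by move=> u; apply/asboolP; exact: Fcongr_refl. Qed.

Lemma Fcongrb_sym : symmetric Fcongrb.
Proof. by move=> u v; apply/asboolP/asboolP; exact: Fcongr_sym. Qed.

Lemma Fcongrb_trans : transitive Fcongrb.
Proof.
move=> v u t /asboolP uv /asboolP vt.
by apply/asboolP; exact: Fcongr_trans vt.
Qed.

HB.instance Definition _ := Choice.on (word nat).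

Canonical Fcongr_equiv := EquivRel Fcongrb Fcongrb_refl Fcongrb_sym Fcongrb_trans.

Definition thompsonF := {eq_quot Fcongr_equiv}%qT.

HB.instance Definition _ := Choice.on thompsonF.
HB.instance Definition _ := EqQuotient.on thompsonF.

Definition class_of_word (u : word nat) : thompsonF := (\pi_thompsonF u)%qT.

Lemma class_eqP u v : class_of_word u = class_of_word v <-> Fcongr u v.
Proof.
split=> [/eqP|uv]; first by rewrite /class_of_word eqmodE => /asboolP.
by apply/eqP; rewrite /class_of_word eqmodE; apply/asboolP.
Qed.

Lemma repr_congr u : Fcongr (repr (class_of_word u)) u.
Proof. by apply/class_eqP; rewrite /class_of_word reprK. Qed.

Lemma class_ex (w : thompsonF) : exists u, w = class_of_word u.
Proof. by exists (repr w); rewrite /class_of_word reprK. Qed.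

Definition Fmul (w1 w2 : thompsonF) := class_of_word (repr w1 ++ repr w2).
Definition Finv (w : thompsonF) := class_of_word (inv_word (repr w)).
Definition Fone := class_of_word [::].

Lemma Fmul_class u v :
  Fmul (class_of_word u) (class_of_word v) = class_of_word (u ++ v).
Proof. by apply/class_eqP; apply: Fcongr_cat; exact: repr_congr. Qed.

Lemma Finv_class u : Finv (class_of_word u) = class_of_word (inv_word u).
Proof. by apply/class_eqP; apply: Fcongr_inv; exact: repr_congr. Qed.

Lemma FmulA : associative Fmul.
Proof.
move=> w1 w2 w3; have [u ->] := class_ex w1; have [v ->] := class_ex w2.
by have [t ->] := class_ex w3; rewrite !Fmul_class catA.
Qed.

Lemma Fmul1 : left_id Fone Fmul.
Proof. by move=> w; have [u ->] := class_ex w; rewrite Fmul_class. Qed.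

Lemma FmulN1 : right_id Fone Fmul.
Proof. by move=> w; have [u ->] := class_ex w; rewrite Fmul_class cats0. Qed.

Lemma FmulV : left_inverse Fone Finv Fmul.
Proof.
move=> w; have [u ->] := class_ex w; rewrite Finv_class Fmul_class.
by apply/class_eqP; exact: Fcongr_invl.
Qed.

Lemma FmulxV : right_inverse Fone Finv Fmul.
Proof.
move=> w; have [u ->] := class_ex w; rewrite Finv_class Fmul_class.
by apply/class_eqP; exact: Fcongr_invr.
Qed.

HB.instance Definition _ :=
  isGroup.Build thompsonF FmulA Fmul1 FmulN1 FmulV FmulxV.

Definition x_ (k : nat) : thompsonF := class_of_word [:: (k, false)].

Lemma x_rel i j : (i < j)%N -> (x_ i)^-1 * x_ j * x_ i = x_ j.+1.
Proof.
move=> ij; rewrite /x_ -[_^-1]/(Finv _) Finv_class.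
rewrite -[_ * _ * _]/(Fmul (Fmul _ _) _) !Fmul_class.
by apply/class_eqP; exact: Fcongr_rel.
Qed.

Definition letter_elt (a : 'I_2 * bool) : thompsonF :=
  if a.2 then (x_ a.1)^-1 else x_ a.1.

Definition word_elt (u : word 'I_2) : thompsonF :=
  \prod_(a <- u) letter_elt a.

Lemma word_elt_cat u v : word_elt (u ++ v) = word_elt u * word_elt v.
Proof. by rewrite /word_elt big_cat. Qed.

Lemma word_elt_inv u : word_elt (inv_word u) = (word_elt u)^-1.
Proof.
elim: u => [|a u IHu]; first by rewrite /word_elt !big_nil invg1.
rewrite -cat1s inv_word_cat !word_elt_cat IHu invgM; congr (_ * _).
by rewrite /word_elt !big_seq1 /letter_elt /=; case: a.2; rewrite ?invgK.
Qed.

Lemma word_elt_x k : exists u, word_elt u = x_ k.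
Proof.
elim: k => [|k [u hu]].
  by exists [:: (ord0, false)]; rewrite /word_elt big_seq1.
case: k u hu => [|k] u hu.
  by exists [:: (ord_max, false)]; rewrite /word_elt big_seq1.
exists ([:: (ord0, true)] ++ u ++ [:: (ord0, false)]).
by rewrite !word_elt_cat hu /word_elt !big_seq1 mulgA x_rel.
Qed.

Lemma x0_x1_generate w : exists n, `[< exists2 u, word_elt u = w & size u = n >].
Proof.
suff [u hu] : exists u, word_elt u = w.
  by exists (size u); apply/asboolP; exists u.
have [v ->] := class_ex w.
elim: v => [|[k b] v [u hu]]; first by exists [::]; rewrite /word_elt big_nil.
have [t ht] := word_elt_x k.
rewrite -cat1s -Fmul_class -hu; case: b.
  exists (inv_word t ++ u).
  by rewrite word_elt_cat word_elt_inv ht /x_ -[_^-1]/(Finv _) Finv_class.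
by exists (t ++ u); rewrite word_elt_cat ht.
Qed.

Definition word_length (w : thompsonF) : nat := ex_minn (x0_x1_generate w).

(* pos and neg list the pairs (i, r) and (j, s) by increasing index. *)
Definition normal_form (pos neg : seq (nat * nat)) : Prop :=
  [/\ all (fun p => 0 < p.2)%N (pos ++ neg),
      sorted ltn (unzip1 pos), sorted ltn (unzip1 neg)
    & forall i, i \in unzip1 pos -> i \in unzip1 neg ->
        (i.+1 \in unzip1 pos) || (i.+1 \in unzip1 neg)].

Definition normal_form_elt (pos neg : seq (nat * nat)) : thompsonF :=
  (\prod_(p <- pos) x_ p.1 ^+ p.2) * (\prod_(q <- rev neg) x_ q.1 ^- q.2).

(* The identity, with empty normal form, is both strictly positive and *)
(* strictly negative. *)
Definition strictly_positive (w : thompsonF) : Prop :=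
  exists pos neg, [/\ normal_form pos neg, normal_form_elt pos neg = w
                    & neg = [::]].

Definition strictly_negative (w : thompsonF) : Prop :=
  exists pos neg, [/\ normal_form pos neg, normal_form_elt pos neg = w
                    & pos = [::]].

Inductive tree : Type :=
| Leaf
| Caret (l r : tree).

(* A vertex of a tree is given by its address: the path leading to it from *)
(* the root, each step going either left or right. *)
Notation goL := false (only parsing).
Notation goR := true (only parsing).

Definition address := seq bool.

Definition on_left_side (p : address) := all (pred1 goL) p.
Definition on_right_side (p : address) := all (pred1 goR) p.

Fixpoint leaves_from (p : address) (T : tree) : seq address :=
  if T is Caret l r
  then leaves_from (rcons p goL) l ++ leaves_from (rcons p goR) r
  else [:: p].

Definition leaves (T : tree) : seq address := leaves_from [::] T.

Fixpoint carets_from (p : address) (T : tree) : seq address :=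
  if T is Caret l r
  then carets_from (rcons p goL) l ++ p :: carets_from (rcons p goR) r
  else [::].

(* Caret number k, in infix order, is the k-th element of this sequence. *)
Definition carets (T : tree) : seq address := carets_from [::] T.

(* The m last edges of p are left edges, and the path they form does not *)
(* reach the right side; below its top vertex such a path never meets the *)
(* right side. *)
Definition left_path (p : address) (m : nat) : bool :=
  all (pred1 goL) (drop (size p - m) p)
  && ~~ on_right_side (take (size p - m) p).

Definition leaf_exponent (p : address) : nat :=
  \max_(m < (size p).+1 | left_path p m) m.

Definition exponent (T : tree) (k : nat) : nat :=
  leaf_exponent (nth [::] (leaves T) k).

Definition diagram_elt (Tm Tp : tree) : thompsonF :=
  (\prod_(k <- iota 0 (size (leaves Tp))) x_ k ^+ exponent Tp k)
  * (\prod_(k <- rev (iota 0 (size (leaves Tm)))) x_ k ^- exponent Tm k).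

Definition exposed_caret (T : tree) (m : nat) : Prop :=
  exists p, [/\ (m.+1 < size (leaves T))%N,
                nth [::] (leaves T) m = rcons p goL
              & nth [::] (leaves T) m.+1 = rcons p goR].

Definition unreduced (Tm Tp : tree) : Prop :=
  exists m, exposed_caret Tm m /\ exposed_caret Tp m.

Definition reduced_diagram (w : thompsonF) (Tm Tp : tree) : Prop :=
  [/\ size (carets Tm) = size (carets Tp),
      diagram_elt Tm Tp = w,
      w = 1 -> Tm = Caret Leaf Leaf /\ Tp = Caret Leaf Leaf
    & w <> 1 -> ~ unreduced Tm Tp].

(* The tree * with n carets. *)
Definition right_vine (n : nat) : tree := iter n (Caret Leaf) Leaf.

Variant caret_kind := L0 | LL | I0 | IR | RI | RNI | R0.

Definition left_caret (p : address) := on_left_side p.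
Definition right_caret (p : address) := (p != [::]) && on_right_side p.
Definition interior_caret (p : address) := ~~ left_caret p && ~~ right_caret p.

(* The default value [::] of nth is the root, which is not interior. *)
Definition caret_type (T : tree) (p : address) : caret_kind :=
  let cs := carets T in
  let k := index p cs in
  if left_caret p then (if k == 0%N then L0 else LL)
  else if right_caret p then
    if interior_caret (nth [::] cs k.+1) then RI
    else if has interior_caret (drop k.+1 cs) then RNI else R0
  else if rcons p goR \in cs then IR else I0.

Definition x0  : word 'I_2 := [:: (ord0, false)].
Definition x0V : word 'I_2 := [:: (ord0, true)].
Definition x1V : word 'I_2 := [:: (ord_max, true)].

(* W(S) for the subtree S of T rooted at address p. *)
Fixpoint traversal (T : tree) (p : address) (S : tree) : word 'I_2 :=
  if S is Caret l r then
    let u := traversal T (rcons p goL) l in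
    let v := traversal T (rcons p goR) r in
    match caret_type T p with
    | L0 | R0 => u ++ v
    | LL => u ++ x0V ++ v
    | I0 => u ++ x1V
    | IR => u ++ x0V ++ v ++ x0 ++ x1V
    | RNI | RI => u ++ x0V ++ v ++ x0
    end
  else [::].

Definition tree_word (T : tree) : word 'I_2 := traversal T [::] T.

Definition negative_output (w : thompsonF) (u : word 'I_2) : Prop :=
  exists T, reduced_diagram w T (right_vine (size (carets T)))
            /\ u = tree_word T.

(* u is the output of the nested traversal method on w. *)
Definition nested_traversal (w : thompsonF) (u : word 'I_2) : Prop :=
  (strictly_negative w /\ negative_output w u)
  \/ (strictly_positive w
      /\ exists2 v, negative_output w^-1 v & u = inv_word v).

(* Main.v *)
Require Import Defs.
From HB Require Import structures.
From mathcomp Require Import all_boot.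
From mathcomp Require Import boolp.
From mathcomp Require Import zify.

Set Implicit Arguments.
Unset Strict Implicit.

(* F acts on the nodes of the infinite binary tree, identified with their       *)
(* addresses, x_k being the rotation at the k-th node of the right side. If w   *)
(* has diagram (T, * ), then it sends the k-th node of the right side to caret  *)
(* k of T. Under the action of a generator exactly one node enters or leaves    *)
(* the right side, so the length of a word is at least the total number of such *)
(* crossings along the trajectories of the carets of *. The crossings of caret  *)
(* k have a parity forced by the type of caret k of T, and are at least as many *)
(* as the letters the traversal spends on that caret: a caret of the right side *)
(* that never leaves it shields all later carets, and one that leaves it once,  *)
(* for the interior, keeps forever the same next node, hence ends with no right *)
(* child. That the output represents w is an identity in F: the normal form of  *)
(* a subtree with left and right parts l, r hanging from caret b of the right   *)
(* side is x_b P_(b+1)(r) P_b(l), and conjugation by x_0 shifts b.              *)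

Local Open Scope group_scope.

(** * The action on addresses and the crossings of the right side *)

(** An address stands for the midpoint of a dyadic interval of [0,1], and [rotation_at k] is the
    usual piecewise linear action of [x_ k] on these points. If [w] is the inverse of
    [spine_elt 0 T], then [w] sends [nseq k goR] to caret [k] of [T] ([actF_carets]), whichever word
    spells [w].

    A letter makes at most one node cross the border of the right side, so distinct nodes cannot
    cross more often in total than there are letters ([sum_crossings]). Caret [k] crosses at least
    [caret_cost] times ([caret_cost_crossings]). The number is odd if it starts on the right side
    and ends off it. If it ends on the right side with an interior caret after it, zero is
    impossible by [crossings0_right]. If it ends interior with a right child, one is impossible by
    [crossings1_next]. The traversal spends no more letters than that ([size_traversal]), hence
    [size_tree_word_min].

    That the word represents [w] is [tree_word_elt], an identity in the group resting on
    [subtree_elt_comm] and on conjugation by [x_ 0]. Strictly positive elements follow by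
    inversion. *)

Definition rotation (inv : bool) (p : address) : address :=
  match inv, p with
  | false, [::] => [:: goR]
  | false, [:: goL] => [::]
  | false, goL :: goL :: q => goL :: q
  | false, goL :: goR :: q => goR :: goL :: q
  | false, goR :: q => goR :: goR :: q
  | true, [::] => [:: goL]
  | true, [:: goR] => [::]
  | true, goR :: goR :: q => goR :: q
  | true, goR :: goL :: q => goL :: goR :: q
  | true, goL :: q => goL :: goL :: q
  end.

Fixpoint rotation_at (k : nat) (inv : bool) (p : address) : address :=
  match k, p with
  | 0, _ => rotation inv p
  | k'.+1, goR :: q => goR :: rotation_at k' inv q
  | _, _ => p
  end.

Lemma rotation_atK k b : cancel (rotation_at k b) (rotation_at k (~~ b)).
Proof.
elim: k => [|k IHk] [|c p] //=; first by case: b.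
- by case: b c p => [] [] [|[] p].
- by case: c => //=; rewrite IHk.
Qed.

Lemma rotation_at_rel i j p : (i < j)%N ->
  rotation_at i false (rotation_at j false (rotation_at i true p))
    = rotation_at j.+1 false p.
Proof.
elim: i j p => [|i IHi] [|j] //= [|[] p] //= ij; last by rewrite IHi.
by case: p => [|[] p].
Qed.

Definition act (p : address) (u : word nat) : address :=
  foldl (fun q a => rotation_at a.1 a.2 q) p u.

Lemma act_cat p u v : act p (u ++ v) = act (act p u) v.
Proof. exact: foldl_cat. Qed.

Lemma act_congr u v : Fcongr u v -> forall p, act p u = act p v.
Proof.
elim=> {u v} [||||a|i j ij] //.
- by move=> u v t _ uv _ vt p; rewrite uv vt.
- by move=> u u' v v' _ uu' _ vv' p; rewrite !act_cat uu' vv'.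
- by move=> p; rewrite /act /= rotation_atK.
- by move=> p; rewrite /act /= rotation_at_rel.
Qed.

Definition actF (p : address) (w : thompsonF) : address := act p (repr w).

Lemma actF_class p u : actF p (class_of_word u) = act p u.
Proof. exact/act_congr/repr_congr. Qed.

Lemma actF1 p : actF p 1 = p.
Proof. by rewrite -[1]/Fone /Fone actF_class. Qed.

Lemma actFM p w1 w2 : actF p (w1 * w2) = actF (actF p w1) w2.
Proof.
have [u ->] := class_ex w1; have [v ->] := class_ex w2.
by rewrite -[_ * _]/(Fmul _ _) Fmul_class !actF_class act_cat.
Qed.

Lemma actF_x p k : actF p (x_ k) = rotation_at k false p.
Proof. exact: actF_class. Qed.

Lemma actF_xV p k : actF p (x_ k)^-1 = rotation_at k true p.
Proof. by rewrite -[_^-1]/(Finv _) /x_ Finv_class actF_class. Qed.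

Definition step (p : address) (a : 'I_2 * bool) : address :=
  rotation_at a.1 a.2 p.

Lemma step_inj a : injective (step^~ a).
Proof. exact: can_inj (rotation_atK _ _). Qed.

Lemma actF_word p (u : word 'I_2) : actF p (word_elt u) = foldl step p u.
Proof.
elim: u p => [|a u IHu] p; first by rewrite /word_elt big_nil actF1.
rewrite /word_elt big_cons actFM -/(word_elt u) IHu /=; congr foldl.
by rewrite /letter_elt /step; case: a.2; rewrite ?actF_xV ?actF_x.
Qed.

(** * Crossings along a word *)

Definition crossing (p : address) (a : 'I_2 * bool) : bool :=
  right_caret p != right_caret (step p a).

Fixpoint crossings (p : address) (u : word 'I_2) : nat :=
  if u is a :: v then crossing p a + crossings (step p a) v else 0.

(** The crossing node is the root for [x_ 0], [[:: goR; goL]] for [x_ 1], and [[:: goR]] for either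
    inverse. *)
Lemma crossing_unique p q a : crossing p a -> crossing q a -> p = q.
Proof.
rewrite /crossing /step /right_caret /on_right_side.
case: a => -[[|[|//]] ?] [].
- case: p => [|[] [|[] p]] //=; rewrite ?eqxx //;
  by case: q => [|[] [|[] q]] //=; rewrite ?eqxx.
- case: p => [|[] [|[] p]] //=; rewrite ?eqxx //;
  by case: q => [|[] [|[] q]] //=; rewrite ?eqxx.
- case: p => [|[] [|[] [|[] p]]] //=; rewrite ?eqxx //;
  by case: q => [|[] [|[] [|[] q]]] //=; rewrite ?eqxx.
- case: p => [|[] [|[] [|[] p]]] //=; rewrite ?eqxx //;
  by case: q => [|[] [|[] [|[] q]]] //=; rewrite ?eqxx.
Qed.

Lemma sum_crossings ps u : uniq ps -> (\sum_(p <- ps) crossings p u <= size u)%N.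
Proof.
elim: u ps => [|a u IHu] ps ps_uniq /=; first by rewrite big1_eq.
rewrite big_split /= -add1n leq_add //; last first.
  rewrite -(big_map (step^~ a) xpredT (fun p => crossings p u)) /=.
  by rewrite IHu // (map_inj_uniq (@step_inj a)).
elim: ps ps_uniq => [|p ps IHps] /=; first by rewrite big_nil.
case/andP=> pps /IHps; rewrite big_cons; case: (boolP (crossing p a)) => // pa _.
rewrite big1_seq // => q /= qps; apply/eqP; rewrite eqb0.
by apply: contra pps => qa; rewrite (crossing_unique pa qa).
Qed.

Lemma odd_crossings p u :
  odd (crossings p u) = right_caret p (+) right_caret (foldl step p u).
Proof.
elim: u p => [|a u IHu] p /=; first by rewrite addbb.
rewrite oddD IHu oddb /crossing.
by case: (right_caret p); case: (right_caret (step p a)); case: (right_caret _).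
Qed.

(** The right side is rigid: a letter that keeps one of its nodes there translates everything below
    that node along with it. *)
Lemma step_nseq k a : (0 < k)%N -> ~~ crossing (nseq k goR) a ->
  exists2 k', (0 < k')%N &
    forall m, step (nseq (k + m) goR) a = nseq (k' + m) goR.
Proof.
case: k => // k _; rewrite /crossing /right_caret /on_right_side /step.
case: a => -[[|[|//]] i_lt] [] /=; case: k => [|k] //= _.
- by exists k.+1.
- by exists 2.
- by exists k.+3.
- by exists k.+1 => // m; rewrite addSn; case: (k + m)%N.
- by exists 2 => // -[].
- by exists k.+3 => // m; rewrite addSn; case: (k + m)%N.
Qed.

Lemma crossings0_right k u : (0 < k)%N -> crossings (nseq k goR) u = 0 ->
  exists k', forall m, foldl step (nseq (k + m) goR) u = nseq (k' + m) goR.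
Proof.
elim: u k => [|a u IHu] k k0 /=; first by exists k.
move/eqP; rewrite addn_eq0 eqb0 => /andP[ka /eqP].
have [k' k'0 E] := step_nseq k0 ka.
have := E 0; rewrite !addn0 => ->; case/(IHu _ k'0) => k'' E'.
by exists k'' => m; rewrite E E'.
Qed.

(** The only exit from the left side is the move from the root to [[:: goR]], which is a
    crossing. *)
Lemma crossings0_left p u : left_caret p -> crossings p u = 0 ->
  left_caret (foldl step p u).
Proof.
elim: u p => [|a u IHu] //= p pL /eqP; rewrite addn_eq0 eqb0.
case/andP=> pa /eqP; apply: IHu; move: pL pa.
rewrite /crossing /left_caret /on_left_side /right_caret /on_right_side /step.
case: a => -[[|[|//]] i_lt] [] /=; case: p => [|[] [|[] p]] //=.
Qed.

Lemma step_interior p a : interior_caret p -> ~~ crossing p a ->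
  interior_caret (step p a).
Proof.
rewrite /interior_caret => /andP[pL /negbTE pR].
rewrite /crossing pR eq_sym negb_eqb addbF => /[dup] sR ->; rewrite andbT.
move: pL pR sR.
rewrite /left_caret /on_left_side /right_caret /on_right_side /step.
by case: a => -[[|[|//]] i_lt] []; case: p => [|[] [|[] [|[] p]]].
Qed.

(* The address of an interior node p has the form [e ++ goL :: goR^i]; here e *)
(* is the node following all the descendants of p in infix order. *)
Lemma crossings0_next e i u (p := e ++ goL :: nseq i goR) :
  interior_caret p -> crossings p u = 0 ->
  exists i', foldl step p u = foldl step e u ++ goL :: nseq i' goR.
Proof.
rewrite {}/p; elim: u e i => [|a u IHu] e i /=; first by exists i.
move=> eI /eqP; rewrite addn_eq0 eqb0 => /andP[ea /eqP].
have [i' E] : exists i', step (e ++ goL :: nseq i goR) a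
                         = step e a ++ goL :: nseq i' goR.
  move: eI ea; rewrite /crossing /step.
  rewrite /interior_caret /left_caret /on_left_side /right_caret /on_right_side.
  case: a => -[[|[|//]] i_lt] [].
  - by case: e => [|[] [|[] e]] /=; [exists i|exists i.+1|exists i..].
  - case: e => [|[] [|[] e]] /=; [|by exists i..].
    by case: i => //= i _ _; exists i.
  - by case: e => [|[] [|[] [|[] e]]] /=; [exists i|exists i|exists i.+1|exists i..].
  - case: e => [|[] [|[] [|[] e]]] /=; [by exists i| |by exists i..].
    by case: i => //= i _ _; exists i.
by rewrite E; apply: IHu; rewrite -E step_interior.
Qed.

(* Leaving the right side at a node of the interior happens by the rotation *)
(* [goR] -> [goR; goL], which moves the next node to [goR]. *)
Lemma crossings1_next k u : (0 < k)%N -> crossings (nseq k goR) u = 1%N ->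
  interior_caret (foldl step (nseq k goR) u) ->
  exists i, foldl step (nseq k goR) u
            = foldl step (nseq k.+1 goR) u ++ goL :: nseq i goR.
Proof.
elim: u k => [|a u IHu] k k0 //=.
case: (boolP (crossing (nseq k goR) a)) => [ka|ka]; last first.
  have [k' k'0 E] := step_nseq k0 ka.
  have E0 := E 0; have E1 := E 1%N; rewrite !addn0 in E0.
  rewrite !addn1 in E1.
  by rewrite add0n -/(nseq k.+1 goR) E0 E1; apply: IHu.
rewrite addSn add0n => -[].
(* The other way off the right side is through the root; from there the node could become interior
   only by crossing again. *)
have [sL|[-> ->]] : left_caret (step (nseq k goR) a) \/
    (step (nseq k goR) a = [:: goR; goL] /\ step (goR :: nseq k goR) a = [:: goR]).
  move: ka; rewrite /crossing /right_caret /on_right_side /step.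
  case: k k0 => // k _; case: a => -[[|[|//]] i_lt] [] /=;
    case: k => [|[|k]] //=; rewrite ?all_pred1_nseq ?eqxx ?orbT //= => _; by [left|right].
- by move=> /(crossings0_left sL) sL'; rewrite /interior_caret sL'.
- move=> u0 _; exact: (@crossings0_next [:: goR] 0).
Qed.

(** * The diagram of a negative element *)

Definition ncarets (S : tree) : nat := size (carets S).

Lemma size_carets_from p S : size (carets_from p S) = ncarets S.
Proof.
rewrite /ncarets /carets; move: [::]; elim: S p => [|l IHl r IHr] //= p q.
by rewrite !size_cat /= (IHl _ (rcons q goL)) (IHr _ (rcons q goR)).
Qed.

Lemma ncarets_Caret l r : ncarets (Caret l r) = (ncarets l + (ncarets r).+1)%N.
Proof. by rewrite /ncarets size_cat /= !size_carets_from. Qed.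

Lemma size_leaves_from p S : size (leaves_from p S) = (ncarets S).+1.
Proof.
elim: S p => [|l IHl r IHr] //= p.
by rewrite size_cat IHl IHr ncarets_Caret addSn.
Qed.

(** The normal form factor of a subtree whose first leaf is number [b], with exponents counted
    inside the subtree. Writing [r] before [l] makes the index of [r] independent of the size of
    [l]. *)
Fixpoint subtree_elt (b : nat) (S : tree) : thompsonF :=
  if S is Caret l r then x_ b * subtree_elt b.+1 r * subtree_elt b l else 1.

Fixpoint spine_elt (b : nat) (S : tree) : thompsonF :=
  if S is Caret l r then spine_elt b.+1 r * subtree_elt b l else 1.

Lemma x_comm i j : (i < j)%N -> x_ j * x_ i = x_ i * x_ j.+1.
Proof. by move=> ij; rewrite -(x_rel ij) !mulgA mulgV mul1g. Qed.

(** Passing one generator of smaller index raises the index by one, and [subtree_elt b S] has one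
    generator per caret. *)
Lemma x_subtree_comm b j S : (b < j)%N ->
  x_ j * subtree_elt b S = subtree_elt b S * x_ (j + ncarets S).
Proof.
elim: S b j => [|l IHl r IHr] b j bj; first by rewrite /= mulg1 mul1g addn0.
rewrite ncarets_Caret /= !mulgA x_comm // -(mulgA _ (x_ j.+1)) (IHr b.+1 j.+1) //.
rewrite !mulgA -[LHS]mulgA IHl ?ltn_addr ?(leqW bj) // mulgA.
by rewrite addSnnS -addnA (addnC _.+1).
Qed.

Lemma subtree_elt_comm b j S S' : (b < j)%N ->
  subtree_elt j S' * subtree_elt b S
    = subtree_elt b S * subtree_elt (j + ncarets S) S'.
Proof.
elim: S' j => [|l IHl r IHr] j bj /=; first by rewrite mulg1 mul1g.
rewrite -mulgA IHl // mulgA -(mulgA (x_ j)) IHr ?(leqW bj) //.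
by rewrite !mulgA x_subtree_comm // addSn.
Qed.

Lemma spine_elt_comm b j S S' : (b < j)%N ->
  spine_elt j S' * subtree_elt b S
    = subtree_elt b S * spine_elt (j + ncarets S) S'.
Proof.
elim: S' j => [|l IHl r IHr] j bj /=; first by rewrite mulg1 mul1g.
by rewrite -mulgA subtree_elt_comm // !mulgA IHr ?(leqW bj) // addSn.
Qed.

Lemma x_spine_comm b j S : (b < j)%N ->
  spine_elt j S * x_ b = x_ b * spine_elt j.+1 S.
Proof.
by move=> bj; have := spine_elt_comm (Caret Leaf Leaf) S bj; rewrite /= !mulg1 addn1.
Qed.

(** This is [subtree_elt_comm] past a single caret, whose element at index 0 is [x_ 0]. *)
Lemma subtree_elt_shift b S : (0 < b)%N ->
  (x_ 0)^-1 * subtree_elt b S * x_ 0 = subtree_elt b.+1 S.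
Proof.
move=> b0; have := subtree_elt_comm (Caret Leaf Leaf) S b0.
by rewrite /= !mulg1 addn1 -mulgA => ->; rewrite mulKg.
Qed.

Lemma spine_elt_shift b S : (0 < b)%N ->
  (x_ 0)^-1 * spine_elt b S * x_ 0 = spine_elt b.+1 S.
Proof. by move=> b0; rewrite -mulgA x_spine_comm // mulKg. Qed.

(** * Leaf exponents and the element of a diagram *)

Fixpoint exponents_elt (b : nat) (s : seq nat) : thompsonF :=
  if s is e :: s' then x_ b ^+ e * exponents_elt b.+1 s' else 1.

Lemma exponents_elt_cat b s t :
  exponents_elt b (s ++ t) = exponents_elt b s * exponents_elt (b + size s) t.
Proof.
elim: s b => [|e s IHs] b /=; first by rewrite mul1g addn0.
by rewrite IHs mulgA addSnnS.
Qed.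

Fixpoint subtree_exponents (e : nat) (S : tree) : seq nat :=
  if S is Caret l r then subtree_exponents e.+1 l ++ subtree_exponents 0 r
  else [:: e].

Fixpoint spine_exponents (S : tree) : seq nat :=
  if S is Caret l r then subtree_exponents 0 l ++ spine_exponents r
  else [:: 0].

Lemma size_subtree_exponents e S : size (subtree_exponents e S) = (ncarets S).+1.
Proof.
elim: S e => [|l IHl r IHr] //= e.
by rewrite size_cat IHl IHr ncarets_Caret addSn.
Qed.

Lemma subtree_exponents_elt b e S :
  exponents_elt b (subtree_exponents e S) = x_ b ^+ e * subtree_elt b S.
Proof.
elim: S b e => [|l IHl r IHr] b e //=.
rewrite exponents_elt_cat IHl IHr size_subtree_exponents mul1g expgSr.
by rewrite -!mulgA (@subtree_elt_comm b b.+1) // addSnnS.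
Qed.

Lemma spine_exponents_elt b S :
  exponents_elt b (spine_exponents S) = spine_elt b S.
Proof.
elim: S b => [|l IHl r IHr] b /=; first by rewrite mulg1.
rewrite exponents_elt_cat IHr subtree_exponents_elt size_subtree_exponents mul1g.
by rewrite (@spine_elt_comm b b.+1) // addSnnS.
Qed.

Lemma leaf_exponent_R p : leaf_exponent (rcons p goR) = 0.
Proof.
rewrite /leaf_exponent; rewrite size_rcons; apply: big1 => -[[|m] m_lt] //=.
rewrite /left_path size_rcons subSS => /andP[+ _].
by rewrite drop_rcons ?leq_subr // all_rcons.
Qed.

(** The first left edge upwards ends at [p], so it is refused if [p] is on the right side; otherwise
    every admissible path from [p] gains one edge. *)
Lemma leaf_exponent_L p :
  leaf_exponent (rcons p goL) = if on_right_side p then 0 else (leaf_exponent p).+1.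
Proof.
have lpS m : left_path (rcons p goL) m.+1 = left_path p m.
  rewrite /left_path size_rcons subSS drop_rcons ?leq_subr // all_rcons /=.
  by rewrite -cats1 takel_cat ?leq_subr.
rewrite /leaf_exponent size_rcons big_mkcond big_ord_recl /= if_same max0n.
rewrite (eq_bigr (fun i : 'I_(size p).+1 => if left_path p i then i.+1 else 0)); last first.
  by move=> i _; rewrite /= lpS.
case: ifP => [pR|/negbT pR].
  apply: big1 => m _; rewrite /left_path.
  suff -> : on_right_side (take (size p - m) p) by rewrite andbF.
  by rewrite /on_right_side; move/allP: pR => pR; apply/allP => b /mem_take /pR.
rewrite -(big_mkcond (fun i : 'I_(size p).+1 => left_path p i)) /=.
have lp0 : left_path p (@ord0 (size p)).
  by rewrite /left_path subn0 drop_size take_size.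
apply/eqP; rewrite eqn_leq; apply/andP; split.
  by apply/bigmax_leqP => m pm; rewrite ltnS (leq_bigmax_cond m).
have [m pm mmax] := @arg_maxnP _ ord0 (fun i : 'I_(size p).+1 => left_path p i) id lp0.
by apply: leq_trans (leq_bigmax_cond m pm); rewrite ltnS; apply/bigmax_leqP.
Qed.

Lemma subtree_exponentsE p S : ~~ on_right_side p ->
  [seq leaf_exponent q | q <- leaves_from p S] = subtree_exponents (leaf_exponent p) S.
Proof.
elim: S p => [|l IHl r IHr] //= p pR.
by rewrite map_cat IHl ?IHr ?leaf_exponent_L ?leaf_exponent_R ?(negbTE pR) //
  /on_right_side all_rcons //= negb_and pR.
Qed.

Lemma spine_exponentsE p S : on_right_side p ->
  leaf_exponent p = 0 ->
  [seq leaf_exponent q | q <- leaves_from p S] = spine_exponents S.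
Proof.
elim: S p => [|l IHl r IHr] p pR p0 /=; first by rewrite p0.
rewrite map_cat IHr ?leaf_exponent_R // /on_right_side ?all_rcons //.
by rewrite subtree_exponentsE ?leaf_exponent_L ?pR // /on_right_side all_rcons.
Qed.

Lemma exponentsE T : [seq exponent T k | k <- iota 0 (size (leaves T))] = spine_exponents T.
Proof.
rewrite -(@spine_exponentsE [::]) //; last first.
  by rewrite /leaf_exponent; apply: big1 => -[[|]].
rewrite -[RHS](mkseq_nth 0) size_map; apply/eq_in_map => k.
by rewrite mem_iota add0n => /= k_lt; rewrite (nth_map [::]).
Qed.

Lemma diagram_eltE Tm Tp : diagram_elt Tm Tp = spine_elt 0 Tp * (spine_elt 0 Tm)^-1.
Proof.
suff E T : \prod_(k <- iota 0 (size (leaves T))) x_ k ^+ exponent T k = spine_elt 0 T.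
  by rewrite /diagram_elt prodgV revK !E.
rewrite -spine_exponents_elt -exponentsE.
elim: (size _) 0 => [|n IHn] b; first by rewrite big_nil.
by rewrite /= big_cons IHn.
Qed.

Lemma spine_elt_vine b n : spine_elt b (right_vine n) = 1.
Proof. by elim: n b => [|n IHn] b //=; rewrite IHn mulg1. Qed.

(** * The output of the traversal *)

Lemma prefix_carets_from p S q : q \in carets_from p S -> prefix p q.
Proof.
elim: S p => [|l IHl r IHr] //= p; rewrite mem_cat in_cons => /or3P[/IHl|/eqP->|/IHr].
- by apply: prefix_trans; exact: prefix_rcons.
- exact: prefix_refl.
- by apply: prefix_trans; exact: prefix_rcons.
Qed.

Lemma prefix_rconsF (p q : address) b : prefix (rcons p b) q -> q != p.
Proof.
case/prefixP=> s ->; apply/eqP => /(congr1 size).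
by rewrite size_cat size_rcons => /eqP; rewrite addSn -addnS -{2}[size p]addn0 eqn_add2l.
Qed.

Lemma prefix_rcons_inj (p q : address) b c :
  prefix (rcons p b) q -> prefix (rcons p c) q -> b = c.
Proof.
case/prefixP=> s -> /prefixP[t] /eqP; rewrite !cat_rcons eqseq_cat // eqxx /=.
by rewrite eqseq_cons => /andP[/eqP].
Qed.

(* S is the subtree of T at p, [before] and [after] being the carets of T that *)
(* precede and follow those of S. *)
Record located (T : tree) (p : address) (S : tree) (before after : seq address)
  : Prop := Located {
  located_carets : carets T = before ++ carets_from p S ++ after;
  located_prefix : forall q, q \in before ++ after -> ~~ prefix p q;
  located_left : left_caret p -> before = [::];
  located_right : on_right_side p -> after = [::] }.

Lemma located_root T : located T [::] T [::] [::].
Proof. by split; rewrite ?cats0. Qed.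

Section Located.
Variables (T l r : tree) (p : address) (before after : seq address).
Hypothesis loc : located T p (Caret l r) before after.
Let cl := carets_from (rcons p goL) l.
Let cr := carets_from (rcons p goR) r.

Lemma located_goL : located T (rcons p goL) l before (p :: cr ++ after).
Proof.
have [E P L R] := loc; split; rewrite ?E /= -?catA //.
- move=> q; rewrite mem_cat in_cons mem_cat => /or4P[qb|/eqP->|qr|qa].
  + apply: contra (P q _); last by rewrite mem_cat qb.
    by apply: prefix_trans; exact: prefix_rcons.
  + by apply/negP => /prefix_rconsF; rewrite eqxx.
  + by apply/negP => /prefix_rcons_inj /(_ (prefix_carets_from qr)).
  + apply: contra (P q _); last by rewrite mem_cat qa orbT.
    by apply: prefix_trans; exact: prefix_rcons.
- by rewrite /left_caret /on_left_side all_rcons => /L.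
- by rewrite /on_right_side all_rcons.
Qed.

Lemma located_goR : located T (rcons p goR) r (before ++ cl ++ [:: p]) after.
Proof.
have [E P L R] := loc; split; rewrite ?E /= -?catA //.
- move=> q; rewrite !mem_cat inE => /or4P[qb|ql|/eqP->|qa].
  + apply: contra (P q _); last by rewrite mem_cat qb.
    by apply: prefix_trans; exact: prefix_rcons.
  + by apply/negP => /prefix_rcons_inj /(_ (prefix_carets_from ql)).
  + by apply/negP => /prefix_rconsF; rewrite eqxx.
  + apply: contra (P q _); last by rewrite mem_cat qa orbT.
    by apply: prefix_trans; exact: prefix_rcons.
- by rewrite /left_caret /on_left_side all_rcons.
- by rewrite /on_right_side all_rcons => /R.
Qed.

Lemma located_index : index p (carets T) = size (before ++ cl).
Proof.
have [-> P _ _] := loc; rewrite /= -catA catA index_cat ifN; last first.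
  rewrite mem_cat negb_or; apply/andP; split.
    apply: contraL (prefix_refl p) => pb; apply: P.
    by rewrite mem_cat pb.
  by apply/negP => /prefix_carets_from /prefix_rconsF; rewrite eqxx.
by rewrite /= eqxx addn0.
Qed.

Lemma located_drop : drop (index p (carets T)).+1 (carets T) = cr ++ after.
Proof.
rewrite located_index (located_carets loc) /= -catA catA -add1n -drop_drop.
by rewrite drop_size_cat //= drop0.
Qed.

Lemma located_mem_goR : (rcons p goR \in carets T) = (ncarets r != 0).
Proof.
have [-> P _ _] := loc; rewrite /= !mem_cat in_cons.
have pp := prefix_rcons p goR.
have rF : rcons p goR \notin before ++ after.
  by apply: contraL pp; exact: P.
move: rF; rewrite mem_cat negb_or => /andP[/negbTE-> /negbTE->] /=.
rewrite orbF (negbTE (prefix_rconsF (prefix_refl _))).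
case: (boolP (_ \in carets_from (rcons p goL) l)) => [/prefix_carets_from|_] /=.
  by move=> /prefix_rcons_inj /(_ (prefix_refl _)).
by case: r => [|l' r'] //=; rewrite mem_cat in_cons eqxx orbT ncarets_Caret addnS.
Qed.

End Located.

Lemma located_mem T p S q before after :
  located T p S before after -> q \in carets_from p S ->
  exists l r b a, located T q (Caret l r) b a.
Proof.
elim: S p before after => [|l IHl r IHr] //= p b a loc.
rewrite mem_cat in_cons => /or3P[|/eqP->|].
- exact: IHl (located_goL loc).
- by exists l, r, b, a.
- exact: IHr (located_goR loc).
Qed.

Lemma uniq_carets_from p S : uniq (carets_from p S).
Proof.
elim: S p => [|l IHl r IHr] //= p; rewrite cat_uniq IHl /= IHr andbT.
rewrite negb_or -andbA; apply/and3P; split.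
- by apply/negP => /prefix_carets_from /prefix_rconsF; rewrite eqxx.
- apply/hasPn => q /prefix_carets_from qr; apply/negP => /prefix_carets_from.
  by move=> /prefix_rcons_inj /(_ qr).
- by apply/negP => /prefix_carets_from /prefix_rconsF; rewrite eqxx.
Qed.

Lemma word_elt_nil : word_elt [::] = 1.
Proof. exact: big_nil. Qed.

Lemma word_elt_cons a u : word_elt (a :: u) = letter_elt a * word_elt u.
Proof. exact: big_cons. Qed.

Definition word_eltE := (word_elt_cat, word_elt_cons, word_elt_nil, @mulg1 thompsonF).

Lemma ncarets0 S : ncarets S = 0 -> S = Leaf.
Proof. by case: S => // l r; rewrite ncarets_Caret addnS. Qed.

Lemma interior_goR p : ~~ on_right_side p -> interior_caret (rcons p goR).
Proof.
rewrite /interior_caret /left_caret /right_caret /on_left_side /on_right_side.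
by rewrite !all_rcons /= => /negbTE->; rewrite andbF.
Qed.

Lemma interior_goL p : ~~ left_caret p -> interior_caret (rcons p goL).
Proof.
rewrite /interior_caret /left_caret /right_caret /on_left_side /on_right_side.
by rewrite !all_rcons /= => /negbTE->; rewrite andbF.
Qed.

Lemma interior_not_right p : interior_caret p -> ~~ on_right_side p.
Proof. by rewrite /interior_caret /right_caret; case: p => [|c p] // /andP[]. Qed.

Lemma right_not_left p : right_caret p -> ~~ left_caret p.
Proof. by case: p => [|[] p]. Qed.

(* Interior subtrees, wherever they hang, are written out as if they hung from *)
(* caret 1 of the right side. *)
Lemma traversal_interior T p S before after :
  interior_caret p -> located T p S before after ->
  word_elt (traversal T p S) = (subtree_elt 1 S)^-1.
Proof.
elim: S p before after => [|l IHl r IHr] p b a pI loc /=.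
  by rewrite word_elt_nil invg1.
have [/andP[pL pR] pS] := (pI, interior_not_right pI).
rewrite /caret_type (negbTE pL) (negbTE pR) (located_mem_goR loc).
have {}IHl := IHl _ _ _ (interior_goL pL) (located_goL loc).
have {}IHr := IHr _ _ _ (interior_goR pS) (located_goR loc).
(* Conjugation by [x_ 0] turns the right subtree, written for index 1, into the index 2 required
   after [x_ 1]. *)
rewrite !invgM -(@subtree_elt_shift 1) // !invgM invgK.
case: eqVneq => [/ncarets0 r0|_] /=; rewrite !word_eltE IHl ?IHr.
  by rewrite r0 /= invg1 mul1g mulVg mul1g.
by rewrite /letter_elt /= !mulgA.
Qed.

Lemma caret_type_right T p : right_caret p ->
  if has interior_caret (drop (index p (carets T)).+1 (carets T))
  then caret_type T p = RI \/ caret_type T p = RNI else caret_type T p = R0.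
Proof.
move=> pR; rewrite /caret_type pR (negbTE (right_not_left pR)).
rewrite -[X in nth _ _ X]addn0 -nth_drop.
case: (drop _ _) => [|q s] //=.
by case: (interior_caret q); [left|case: has; [right|]].
Qed.

(** A nonempty left subtree of a right caret has an interior top, so all these subtrees are
    empty. *)
Lemma spine_elt_right_vine b p S : right_caret p ->
  ~~ has interior_caret (carets_from p S) -> spine_elt b S = 1.
Proof.
elim: S b p => [|l _ r IHr] //= b p pR; rewrite has_cat /= !negb_or.
case/and3P=> lF _ rF; rewrite (IHr _ (rcons p goR)) //; last first.
  by move: pR; rewrite /right_caret /on_right_side all_rcons => /andP[_]; case: p {lF rF}.
case: l lF => [|l l'] /=; first by rewrite mulg1.
by rewrite has_cat /= interior_goL ?right_not_left ?orbT.
Qed.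

Lemma traversal_right T p S before after :
  right_caret p -> located T p S before after ->
  word_elt (traversal T p S) = (spine_elt 1 S)^-1.
Proof.
elim: S p before after => [|l _ r IHr] p b a pR loc /=.
  by rewrite word_elt_nil invg1.
have pR' : right_caret (rcons p goR).
  by move: pR; rewrite /right_caret /on_right_side all_rcons => /andP[_]; case: p {loc}.
have {}IHr := IHr _ _ _ pR' (located_goR loc).
have IHl := traversal_interior (interior_goL (right_not_left pR)) (located_goL loc).
have := caret_type_right T pR; rewrite (located_drop loc).
case/andP: (pR) => _ /(located_right loc) ->; rewrite cats0 invgM.
case: ifPn => [_|/(spine_elt_right_vine 1 pR') r1] E.
  rewrite -(@spine_elt_shift 1) // !invgM invgK !mulgA.
  by case: E => -> /=; rewrite !word_eltE IHl IHr /letter_elt /= !mulgA.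
(* Type [R0] omits the conjugation, harmlessly: the right part is trivial. *)
rewrite E word_elt_cat IHl IHr -(@spine_elt_shift 1) // r1.
by rewrite mulg1 mulVg.
Qed.

(** The [x_ 0] of a left caret is written by its parent, which has type [LL] exactly because it has
    a left child. The boolean exponent is the letter that a nonempty [S] still owes. *)
Lemma traversal_left T p S before after :
  left_caret p -> ~~ on_right_side p -> located T p S before after ->
  word_elt (traversal T p S) * (x_ 0) ^- (ncarets S != 0)
    = (subtree_elt 0 S)^-1.
Proof.
elim: S p before after => [|l IHl r _] p b a pL pR loc /=.
  by rewrite /word_elt big_nil mul1g.
rewrite /caret_type pL (located_index loc) (located_left loc pL) /= size_carets_from.
rewrite ncarets_Caret addnS /= !invgM.
have pL' : left_caret (rcons p goL) by rewrite /left_caret /on_left_side all_rcons.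
have pR' : ~~ on_right_side (rcons p goL) by rewrite /on_right_side all_rcons.
rewrite -(IHl _ _ _ pL' pR' (located_goL loc)).
rewrite -(traversal_interior (interior_goR pR) (located_goR loc)) expg1 mulgA.
case: eqP => _ /=; first by rewrite word_elt_cat invg1 mulg1.
by rewrite !word_eltE expg1 /letter_elt /= !mulgA.
Qed.

Lemma tree_word_elt T : word_elt (tree_word T) = (spine_elt 0 T)^-1.
Proof.
case: T => [|l r]; first by rewrite word_elt_nil invg1.
have loc := located_root (Caret l r).
rewrite /tree_word [traversal _ _ _]/= /caret_type (located_index loc) /=.
(* The root contributes no generator of its own; its [x0V], if any, pays what the left subtree
   owes. *)
rewrite size_carets_from invgM.
have /= <- := traversal_left (p := [:: goL]) isT isT (located_goL loc).
have /= <- := traversal_right (p := [:: goR]) isT (located_goR loc).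
by case: eqP => _ /=; rewrite !word_eltE ?expg0 ?invg1 ?mulg1 // /letter_elt /= mulgA.
Qed.

(** * Action of the element of a tree on the right side *)

Lemma rotation_at_fixed b inv q : ~~ prefix (nseq b goR) q ->
  rotation_at b inv q = q.
Proof. by elim: b q => [|b IHb] [|[] q] //= /IHb ->. Qed.

Lemma rotation_at_cat b inv q :
  rotation_at b inv (nseq b goR ++ q) = nseq b goR ++ rotation inv q.
Proof. by elim: b => //= b ->. Qed.

Lemma subtree_elt_fixed b S q : ~~ prefix (nseq b goR) q ->
  actF q (subtree_elt b S)^-1 = q.
Proof.
elim: S b => [|l IHl r IHr] b bq /=; first by rewrite invg1 actF1.
rewrite !invgM !actFM IHl // IHr ?actF_xV ?rotation_at_fixed //.
apply: contra bq; apply: prefix_trans; rewrite -addn1 nseqD; exact: prefix_prefix.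
Qed.

Lemma spine_elt_fixed b S q : ~~ prefix (nseq b goR) q ->
  actF q (spine_elt b S)^-1 = q.
Proof.
elim: S b => [|l IHl r IHr] b bq /=; first by rewrite invg1 actF1.
rewrite invgM actFM subtree_elt_fixed // IHr //.
apply: contra bq; apply: prefix_trans; rewrite -addn1 nseqD; exact: prefix_prefix.
Qed.

Lemma carets_from_cat p q S :
  carets_from (p ++ q) S = [seq p ++ s | s <- carets_from q S].
Proof.
elim: S q => [|l IHl r IHr] //= q.
by rewrite map_cat /= -!IHl -!IHr !rcons_cat.
Qed.

Lemma carets_fromE p S : carets_from p S = [seq p ++ s | s <- carets S].
Proof. by rewrite /carets -carets_from_cat cats0. Qed.

(** Each caret of [S] draws one node off the right side, and the later nodes move up to fill the
    gap. *)
Lemma actF_subtree_spine b S i :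
  actF (nseq (b + (ncarets S + i)) goR) (subtree_elt b S)^-1 = nseq (b + i) goR.
Proof.
elim: S b i => [|l IHl r IHr] b i /=; first by rewrite invg1 actF1.
rewrite !invgM !actFM ncarets_Caret -addnA IHl addSn -addSnnS IHr addSnnS.
by rewrite actF_xV !nseqD rotation_at_cat /=; case: i.
Qed.

Lemma actF_subtree b S :
  [seq actF (nseq i goR) (subtree_elt b S)^-1 | i <- iota b (ncarets S)]
    = carets_from (rcons (nseq b goR) goL) S.
Proof.
elim: S b => [|l IHl r IHr] b //.
rewrite ncarets_Caret iotaD map_cat /= !invgM.
have x_b q : actF (nseq b goR ++ q) (x_ b)^-1 = nseq b goR ++ rotation true q.
  by rewrite actF_xV rotation_at_cat.
(* In infix order: nodes for [l], the top caret, nodes for [r]. Below [nseq b goR], the last factor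
   sends [goL] to [goL goL], the node itself to [goL], and [goR goL] to [goL goR]. *)
congr (_ ++ _ :: _).
- rewrite (eq_map (g := (fun q => actF q (x_ b)^-1)
    \o ((fun q => actF q (subtree_elt b.+1 r)^-1)
    \o (fun i => actF (nseq i goR) (subtree_elt b l)^-1)))); last first.
    by move=> i /=; rewrite !actFM.
  rewrite 2!map_comp IHl -!cats1 -!catA !carets_from_cat -!map_comp.
  apply/eq_in_map => q /prefix_carets_from; case: q => [|[] q] //= _.
  rewrite subtree_elt_fixed ?x_b //.
  by elim: (b).
- rewrite !actFM -[(b + _)%N]addn0 -addnA actF_subtree_spine addn0.
  rewrite subtree_elt_fixed; last by elim: (b).
  by rewrite -[nseq b goR]cats0 x_b cats0 cats1.
- rewrite (addnC b) -addnS iotaDl -map_comp.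
  transitivity [seq actF q (x_ b)^-1 | q <-
    [seq actF (nseq j goR) (subtree_elt b.+1 r)^-1 | j <- iota b.+1 (ncarets r)]].
    rewrite -map_comp; apply/eq_in_map => j; rewrite mem_iota => /andP[/ltnW bj _] /=.
    by rewrite !actFM -(subnKC bj) addnCA actF_subtree_spine.
  have -> : rcons (nseq b goR) goL = nseq b goR ++ [:: goL] by rewrite cats1.
  rewrite IHr !carets_fromE -map_comp; apply: eq_map => q; rewrite [LHS]/comp.
  have -> : rcons (nseq b.+1 goR) goL = nseq b goR ++ [:: goR; goL].
    by elim: (b) => //= n ->.
  by rewrite -catA x_b -cats1 -!catA.
Qed.

Lemma actF_spine b S :
  [seq actF (nseq i goR) (spine_elt b S)^-1 | i <- iota b (ncarets S)]
    = carets_from (nseq b goR) S.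
Proof.
elim: S b => [|l _ r IHr] b //.
rewrite ncarets_Caret iotaD map_cat /= !invgM.
congr (_ ++ _ :: _).
- rewrite -actF_subtree; apply/eq_in_map => j; rewrite mem_iota => /andP[bj jl].
  rewrite actFM spine_elt_fixed //.
  have : actF (nseq j goR) (subtree_elt b l)^-1 \in carets_from (rcons (nseq b goR) goL) l.
    by rewrite -actF_subtree; apply: map_f; rewrite mem_iota bj.
  move/prefix_carets_from; case/prefixP => s ->; rewrite cat_rcons.
  by elim: (b).
- rewrite actFM -[(b + _)%N]addn0 -addnA actF_subtree_spine addn0 spine_elt_fixed //.
  by elim: (b).
- have -> : rcons (nseq b goR) goR = nseq b.+1 goR by elim: (b) => //= n ->.
  rewrite (addnC b) -addnS iotaDl -map_comp -IHr.
  apply/eq_in_map => j; rewrite mem_iota => /andP[/ltnW bj _] /=.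
  by rewrite !actFM -(subnKC bj) addnCA actF_subtree_spine.
Qed.

Lemma actF_carets T k : (k < ncarets T)%N ->
  actF (nseq k goR) (spine_elt 0 T)^-1 = nth [::] (carets T) k.
Proof.
move=> kT; rewrite /carets -(actF_spine 0) (nth_map 0) ?size_iota //.
by rewrite nth_iota.
Qed.

(** * Minimality *)

Definition caret_cost (t : caret_kind) : nat :=
  match t with L0 | R0 => 0 | LL | I0 => 1 | IR => 3 | RI | RNI => 2 end.

(** Only an inequality, since for [I0] the word of [r] is dropped while its costs are summed. *)
Lemma size_traversal T p S :
  (size (traversal T p S) <= \sum_(q <- carets_from p S) caret_cost (caret_type T q))%N.
Proof.
elim: S p => [|l IHl r IHr] //= p; rewrite big_cat big_cons /=.
have := IHl (rcons p goL); have := IHr (rcons p goR).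
by case: caret_type; rewrite !size_cat /= ?size_cat /=; lia.
Qed.

Lemma head_carets_left p S : left_caret p -> left_caret (head p (carets_from p S)).
Proof.
elim: S p => [|l IHl r _] //= p pL.
have pL' : left_caret (rcons p goL) by rewrite /left_caret /on_left_side all_rcons.
by move: (IHl _ pL'); case: (carets_from _ l).
Qed.

Lemma caret_cost_crossings T u k (q := nth [::] (carets T) k) :
  word_elt u = (spine_elt 0 T)^-1 -> (k < ncarets T)%N ->
  (caret_cost (caret_type T q) <= crossings (nseq k goR) u)%N.
Proof.
move=> uT kT.
have step_u j : (j < ncarets T)%N -> foldl step (nseq j goR) u = nth [::] (carets T) j.
  by move=> jT; rewrite -actF_word uT actF_carets.
have qT : q \in carets T by rewrite mem_nth.
have iq : index q (carets T) = k by rewrite index_uniq // uniq_carets_from.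
have {qT} [l [r [b [a loc]]]] := located_mem (located_root T) qT.
have odd_q := odd_crossings (nseq k goR) u; rewrite step_u // -/q in odd_q.
have k0R : (0 < k)%N -> right_caret (nseq k goR).
  by case: (k) => // n _; rewrite /right_caret /on_right_side all_pred1_nseq.
(* Caret 0 is a left caret, so any other kind of caret starts at a proper right node. *)
have k0 : ~~ left_caret q -> (0 < k)%N.
  apply: contraNT; rewrite lt0n negbK => /eqP k0; rewrite /q k0.
  by have := @head_carets_left [::] T isT; rewrite -nth0.
rewrite /caret_type iq.
case: (boolP (left_caret q)) => [qL|qL].
  case: eqP => // /eqP; rewrite -lt0n => /k0R kR.
  move: odd_q; rewrite kR.
  have -> : right_caret q = false by apply: contraTF qL => /right_not_left.
  by case: crossings.
have {}k0 := k0 qL; have {k0R} kR := k0R k0.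
case: (boolP (right_caret q)) => qR.
  (* The number of crossings is even, and zero would keep caret [j] on the right side. *)
  have int_later j : (k < j < ncarets T)%N -> interior_caret (nth [::] (carets T) j) ->
      (1 < crossings (nseq k goR) u)%N.
    move=> /andP[kj jT] jI; move: odd_q; rewrite kR qR.
    case E: (crossings _ _) => [|[|n]] // _.
    have [k' /(_ (j - k))] := crossings0_right k0 E.
    rewrite subnKC ?(ltnW kj) // step_u // => jE; move: jI.
    by rewrite jE => /interior_not_right; rewrite /on_right_side all_pred1_nseq.
  case: ifPn => [kI|_].
    apply: (int_later k.+1) => //; rewrite leqnn /= ltnNge; apply: contraL kI => Tk.
    by rewrite nth_default.
  case: ifPn => [/(has_nthP [::])[j]|_] //.
  rewrite size_drop ltn_subRL nth_drop => jT jI.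
  by apply: int_later jI; rewrite addSn ltnS leq_addr -addSn.
have qI : interior_caret q by rewrite /interior_caret qL qR.
have cross_pos : odd (crossings (nseq k goR) u) by rewrite odd_q kR (negbTE qR).
case: ifPn => [qr|_]; last by case: crossings cross_pos.
suff : crossings (nseq k goR) u != 1%N by case: crossings cross_pos => [|[|[]]].
apply/eqP => c1; have := crossings1_next k0 c1; rewrite step_u // -/q => /(_ qI).
have := located_mem_goR loc; rewrite qr; case: r loc => // r1 r2 loc _.
have k1T : (k.+1 < ncarets T)%N.
  rewrite ltnNge; apply/negP => Tk. have := located_drop loc; rewrite iq drop_oversize //.
  by move/(congr1 size); rewrite size_cat size_carets_from ncarets_Caret addnS.
rewrite step_u // => -[i qE].
(* Caret [k.+1] opens the right subtree of [q], so its address extends [q]; but [qE] makes it a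
   proper prefix of [q]. *)
have := located_drop loc; rewrite iq (drop_nth [::] k1T).
have [c [s sE]] : exists c s, carets_from (rcons q goR) (Caret r1 r2) = c :: s.
  by rewrite /=; case: carets_from => [|c s]; [exists (rcons q goR)|exists c]; eexists.
have /prefix_carets_from : c \in carets_from (rcons q goR) (Caret r1 r2).
  by rewrite sE mem_head.
rewrite sE => /prefixP[t ->] [] E _; move/(congr1 size): qE.
rewrite E !size_cat size_rcons /=; lia.
Qed.

Lemma size_tree_word_min T u : word_elt u = (spine_elt 0 T)^-1 ->
  (size (tree_word T) <= size u)%N.
Proof.
move=> uT; apply: leq_trans (size_traversal _ _ _) _.
have nseq_inj : injective (fun k => nseq k goR).
  by move=> j k /(congr1 size); rewrite !size_nseq.
have := sum_crossings u (ps := [seq nseq k goR | k <- iota 0 (ncarets T)]).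
rewrite (map_inj_uniq nseq_inj) iota_uniq => /(_ isT); apply: leq_trans.
rewrite -/(carets T) (big_nth [::]) big_map /index_iota subn0 -/(ncarets T).
rewrite big_seq [leqRHS]big_seq; apply: leq_sum => k; rewrite mem_iota => kT.
exact: caret_cost_crossings.
Qed.

(** * Existence of the reduced diagram *)

(** Left multiplication by [x_ b] rotates the tree at its root, after adding carets with empty
    subtrees if the right side is too short. *)
Lemma x_spine b T : exists T', spine_elt b T' = x_ b * spine_elt b T.
Proof.
case: T => [|A [|l r]].
- by exists (Caret (Caret Leaf Leaf) Leaf); rewrite /= !mulg1 mul1g.
- by exists (Caret (Caret A Leaf) Leaf); rewrite /= mulg1 !mul1g.
- by exists (Caret (Caret A l) r); rewrite /= !mulgA x_spine_comm.
Qed.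

Lemma sorted_prod_spine b s :
  all (leq b) (unzip1 s) -> sorted ltn (unzip1 s) ->
  exists T, spine_elt b T = \prod_(p <- s) x_ p.1 ^+ p.2.
Proof.
elim: s b => [|[i r] s IHs] b /=; first by exists Leaf; rewrite big_nil.
case/andP=> bi _ is_path.
have [T eT] := IHs i.+1 (order_path_min ltn_trans is_path) (path_sorted is_path).
rewrite big_cons -eT /=.
have [T1 ->] : exists T', x_ i ^+ r * spine_elt i.+1 T = spine_elt i T'.
  elim: r => [|r [T' eT']]; first by exists (Caret Leaf T); rewrite /= mulg1 mul1g.
  by have [T'' eT''] := x_spine i T'; exists T''; rewrite expgS -mulgA eT' eT''.
(* Indices from [b] up to [i] are skipped by right carets with empty left subtree, whose factor is
   trivial. *)
rewrite -(subnKC bi); elim: (i - b)%N T1 => [|d IHd] T1; first by exists T1; rewrite addn0.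
by have [T' eT'] := IHd (Caret Leaf T1); exists T'; rewrite eT' /= mulg1 addnS.
Qed.

(** For a nonempty tree: the last caret of the right side is not exposed, which is what reducedness
    against a right vine demands. *)
Fixpoint tight (T : tree) : bool :=
  match T with
  | Leaf => true
  | Caret l Leaf => ncarets l != 0
  | Caret l r => tight r
  end.

Lemma tightening T : exists2 T', tight T' & forall b, spine_elt b T' = spine_elt b T.
Proof.
elim: T => [|l _ r [r' tr er]]; first by exists Leaf.
case: r' tr er => [|r1 r2] tr er; last by exists (Caret l (Caret r1 r2)) => // b; rewrite /= -er.
case: l => [|l1 l2]; first by exists Leaf => // b; rewrite /= -er mulg1.
exists (Caret (Caret l1 l2) Leaf) => [|b]; last by rewrite /= -er.
by rewrite /tight ncarets_Caret addnS.
Qed.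

Lemma leaves_from_Caret p l r : leaves_from p (Caret l r)
  = leaves_from (rcons p goL) l ++ leaves_from (rcons p goR) r.
Proof. by []. Qed.

Lemma last_leaf_Caret p l r :
  exists q, nth [::] (leaves_from p (Caret l r)) (ncarets (Caret l r)) = rcons q goR.
Proof.
elim: r p l => [|r1 _ r2 IHr] p l.
  exists p; rewrite /= nth_cat size_leaves_from ncarets_Caret addnS addn0 ltnn.
  by rewrite subnn.
have [q qE] := IHr (rcons p goR) r1; exists q; rewrite -qE (leaves_from_Caret p) nth_cat.
by rewrite size_leaves_from ncarets_Caret addnS ltnS ltnNge leq_addr /= subSS addKn.
Qed.

Lemma tight_penultimate_leaf p l r : tight (Caret l r) ->
  exists q, nth [::] (leaves_from p (Caret l r)) (ncarets (Caret l r)).-1 = rcons q goR.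
Proof.
elim: r p l => [|r1 _ r2 IHr] p l.
  case: l => [|l1 l2] // _; have [q qE] := last_leaf_Caret (rcons p goL) l1 l2.
  exists q; rewrite (leaves_from_Caret p) nth_cat size_leaves_from.
  by rewrite ncarets_Caret addnS addn0 leqnn.
move=> t; have [q qE] := IHr (rcons p goR) r1 t; exists q.
rewrite -qE (leaves_from_Caret p) nth_cat size_leaves_from (ncarets_Caret l) addnS /=.
rewrite ncarets_Caret addnS ltnNge /= addnS ltnS leq_addr /=; congr nth; lia.
Qed.

Lemma leaves_vine p n i : (i < n)%N ->
  exists q, nth [::] (leaves_from p (right_vine n)) i = rcons q goL.
Proof.
elim: n p i => [|n IHn] p [|i] //= i_lt; first by exists p.
exact: IHn.
Qed.

Lemma ncarets_vine n : ncarets (right_vine n) = n.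
Proof. by elim: n => //= n IHn; rewrite ncarets_Caret IHn. Qed.

(** The only exposed caret of the vine carries the last two leaves, whereas the last leaf but one of
    a tight tree is a right child. *)
Lemma tight_reduced l r n (T := Caret l r) : tight T -> ncarets T = n ->
  ~ unreduced T (right_vine n).
Proof.
move=> tT nT [m [[p [_ pL _]] [q [m_lt _ qR]]]].
rewrite /leaves size_leaves_from ncarets_vine ltnS in m_lt.
have mn : n = m.+1.
  apply/eqP; rewrite eqn_leq m_lt andbT leqNgt; apply/negP => /(leaves_vine [::])[q'].
  by rewrite -/(leaves _) qR => /rcons_inj[].
have [q'] := tight_penultimate_leaf [::] tT.
by rewrite nT mn -/(leaves T) /= pL => /rcons_inj[].
Qed.

Lemma negative_output_spine T : exists u, negative_output (spine_elt 0 T)^-1 u.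
Proof.
case: (pselect (spine_elt 0 T = 1)) => [T1|T1].
  exists (tree_word (Caret Leaf Leaf)), (Caret Leaf Leaf); split=> //; split=> //.
    by rewrite T1 diagram_eltE spine_elt_vine mul1g.
  by rewrite T1 invg1.
have [T' tT' eT'] := tightening T.
exists (tree_word T'), T'; split=> //; rewrite -eT' in T1 *; split.
- by rewrite -[RHS]/(ncarets _) ncarets_vine.
- by rewrite diagram_eltE spine_elt_vine mul1g.
- by move=> /eqP; rewrite invg_eq1 => /eqP.
- by case: T' tT' {eT'} T1 => [|l r] tT T1 _ //; exact: tight_reduced.
Qed.

(** * Strictly negative and strictly positive elements *)

Lemma negative_output_exists w : strictly_negative w -> exists u, negative_output w u.
Proof.
case=> _ [s [[_ _ s_sorted _] <- ->]].
have [|T eT] := @sorted_prod_spine 0 s _ s_sorted; first by apply/allP.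
rewrite /normal_form_elt big_nil mul1g prodgV revK -eT.
exact: negative_output_spine.
Qed.

Lemma strictly_negativeV w : strictly_positive w -> strictly_negative w^-1.
Proof.
case=> s [t [+ <- t0]]; rewrite {t}t0 => -[s_pos s_sorted _ _]; exists [::], s; split=> //.
  by split=> //; rewrite cats0 in s_pos.
by rewrite /normal_form_elt prodgV revK !big_nil mul1g mulg1.
Qed.

Lemma negative_output_elt w u : negative_output w u -> word_elt u = w.
Proof.
case=> T [[_ <- _ _] ->].
by rewrite diagram_eltE spine_elt_vine mul1g tree_word_elt.
Qed.

Lemma negative_output_min w u v : negative_output w u -> word_elt v = w ->
  (size u <= size v)%N.
Proof.
case=> T [[_ <- _ _] ->]; rewrite diagram_eltE spine_elt_vine mul1g.
exact: size_tree_word_min.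
Qed.

Lemma word_lengthE w u : word_elt u = w ->
  (forall v, word_elt v = w -> (size u <= size v)%N) -> size u = word_length w.
Proof.
move=> uw u_min; rewrite /word_length; case: ex_minnP => n /asboolP[v vw <-] n_min.
apply/eqP; rewrite eqn_leq u_min // n_min //.
by apply/asboolP; exists u.
Qed.

Unset Implicit Arguments.

Theorem theorem6p1 (w : thompsonF)
  (hw : strictly_positive w \/ strictly_negative w) :
  (exists u : word 'I_2, nested_traversal w u) /\
  (forall u : word 'I_2, nested_traversal w u ->
     word_elt u = w /\ size u = word_length w).
Proof.
split=> [|u].
  case: hw => [wP|wN].
    have [v wv] := negative_output_exists (strictly_negativeV wP).
    by exists (inv_word v); right; split=> //; exists v.
  by have [u wu] := negative_output_exists wN; exists u; left.
case=> [[_ wu]|[_ [v wv ->]]].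
  split; first exact: negative_output_elt wu.
  apply: word_lengthE => [|v]; first exact: negative_output_elt wu.
  exact: negative_output_min wu.
have vw : word_elt (inv_word v) = w.
  by rewrite word_elt_inv (negative_output_elt wv) invgK.
split=> //; apply: word_lengthE => // t tw.
(* Inverting words preserves length and exchanges the words for [w] with those for its inverse. *)
have := @negative_output_min _ _ (inv_word t) wv.
by rewrite word_elt_inv tw /inv_word !size_rev !size_map; apply.
Qed.
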